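(* Let $\alpha\in(0,1)$, let $\widehat{\mathcal C^{\rm conf}_{(1-\alpha)}}(X_{T+1})$ be the optimal split distributional conformal prediction set and let $\mathcal C^{\rm opt}_{(1-\alpha)}(x)$ be the optimal prediction interval, both defined in the context. Let $U_t=F(Y_t,X_t)$, and let $b(\cdot,\cdot)$ be the unique function satisfying $b(x,\alpha)\in\arg\min_{z\in[0,\alpha]}\{Q(z+1-\alpha,x)-Q(z,x)\}$ for every $x\in\mathcal X$. Suppose that, as $|\mathcal T_1|,|\mathcal T_2|\to\infty$: 1. $|\mathcal T_2|^{-1}\sum_{t\in\mathcal T_2}(\hat F(Y_t,X_t)-U_t)^2=o_P(1)$ and $|\mathcal T_2|^{-1}\sum_{t\in\mathcal T_2}(\hat b(X_t,\alpha)-b(X_t,\alpha))^2=o_P(1)$. 2. $\sup_{v\in\mathbb R}|\tilde G_*(v)-G_*(v)|=o_P(1)$, where $\tilde G_*(v)=|\mathcal T_2|^{-1}\sum_{t\in\mathcal T_2}\mathbf 1\{\hat V_t^*\le v\}$ and $G_*$ is the distribution function of $V_t^*=U_t-b(X_t,\alpha)-\tfrac12(1-\alpha)$. 3. There exists a constant $C_1>0$ such that for any $x\in\mathcal X$, $\inf_{y\in s(x)}f(y,x)\ge C_1$, where $f(y,x)=\partial F(y,x)/\partial y$ and $s(x)=[s_1(x),s_2(x)]$ is the support of the conditional distribution of $Y_t$ given $X_t=x$. 4. $\sup_{y\in\mathbb R}|\hat F(y,X_{T+1})-F(y,X_{T+1})|=o_P(1)$ and $\hat b(X_{T+1},\alpha)=b(X_{T+1},\alpha)+o_P(1)$.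 5. There exists a constant $C_2>0$ such that $\max\{|s_1(x)|,|s_2(x)|\}\le C_2$ for any $x\in\mathcal X$. Then $$\mu\left(\widehat{\mathcal C^{\rm conf}_{(1-\alpha)}}(X_{T+1})\,\triangle\,\mathcal C^{\rm opt}_{(1-\alpha)}(X_{T+1})\right)=o_P(1),$$ where $\mu$ is Lebesgue measure and $A\triangle B=(A\setminus B)\cup(B\setminus A)$.
   Context: The data are random pairs $(Y_t,X_t)$, $1\le t\le T+1$, with $Y_t$ real-valued and $X_t$ a vector of predictors with support $\mathcal X$. $F(y,x)=P(Y_t\le y\mid X_t=x)$ (the same for all $t$), with $F(\cdot,X_t)$ continuous almost surely, and $Q(\tau,x)$ is the $\tau$-quantile of $Y_t$ given $X_t=x$. Since the support of $Y_t$ given $X_t=x$ is a bounded interval on which $F(\cdot,x)$ is strictly increasing, $Q(0,x)$ and $Q(1,x)$ are the endpoints of that support. Optimal interval: $\mathcal C^{\rm opt}_{(1-\alpha)}(x)=[r_1(x,\alpha),r_2(x,\alpha)]$, where $(z_1,z_2)=(r_1(x,\alpha),r_2(x,\alpha))$ attains, for each $x\in\mathcal X$, the minimum of $z_2-z_1$ subject to $F(z_2,x)-F(z_1,x)\ge 1-\alpha$. Optimal split procedure: split $\{1,\dots,T\}$ into $\mathcal T_1=\{1,\dots,T_0\}$ and $\mathcal T_2=\{T_0+1,\dots,T\}$. From $\{(Y_t,X_t)\}_{t\in\mathcal T_1}$ compute an estimator $\hat F(y,x)$ of $F(y,x)$, monotone in $y$; let $\hat Q(\tau,x)=\inf\{y:\hat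 F(y,x)\ge\tau\}$, and let $\hat b(x,\alpha)\in[0,\alpha]$ be a function satisfying $$\hat Q(\hat b(x,\alpha)+1-\alpha,x)-\hat Q(\hat b(x,\alpha),x)=\min_{z\in[0,\alpha]}\left\{\hat Q(z+1-\alpha,x)-\hat Q(z,x)\right\}.$$ For $t\in\mathcal T_2$ let $\hat V_t^*=\hat F(Y_t,X_t)-\hat b(X_t,\alpha)-\tfrac12(1-\alpha)$, and let $\hat Q^*_{\mathcal T_2}$ be the $(1-\alpha)(1+1/|\mathcal T_2|)$ empirical quantile of $\{|\hat V_t^*|\}_{t\in\mathcal T_2}$. The prediction set is $$\widehat{\mathcal C^{\rm conf}_{(1-\alpha)}}(X_{T+1})=\left\{y:\left|\hat F(y,X_{T+1})-\hat b(X_{T+1},\alpha)-\tfrac12(1-\alpha)\right|\le\hat Q^*_{\mathcal T_2}\right\}.$$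
   Formalization: The displayed claim can fail when b(X_t,α) equals 0 or α with positive probability; it is proved with the prediction set intersected with the support s(X_{T+1}), and as displayed if 0<b(X_t,α)<α a.s. for all t. The bound f≥C_1 is required only in the interior of s(x). *)

(* Defs.v *)
From HB Require Import structures.
Set Warnings "-notation-overridden,-ambiguous-paths,-notation-incompatible-prefix".
From mathcomp Require Export all_boot all_order all_algebra.
From mathcomp Require Export all_classical all_reals all_analysis.
Set Implicit Arguments.
Unset Strict Implicit.
Unset Printing Implicit Defensive.
Export Order.TTheory GRing.Theory Num.Theory.
Export numFieldNormedType.Exports.
#[global] Open Scope classical_set_scope.
#[global] Open Scope ring_scope.

(* R^p with its Borel sigma-algebra *)
Notation borel_rV R p := (g_sigma_algebraType (@open 'rV[R]_p)).

(* Z_n = o_P(1). [mu_ext P] is the outer measure of P: it agrees with P on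
   measurable sets, so this is convergence to 0 in probability whenever the
   Z_n are measurable, and outer convergence otherwise (suprema over an
   uncountable index need not be measurable). Z_n may take infinite values. *)
Definition oP (R : realType) d (Omega : measurableType d)
    (P : probability Omega R) (Z : nat -> Omega -> \bar R) : Prop :=
  forall e : R, 0 < e ->
    mu_ext P [set w | (e%:E < `|Z n w|)%E] @[n --> \oo] --> 0%E.

(* S is the smallest closed set of full measure *)
Definition is_support (R : realType) (V : topologicalType)
    (mu : set V -> \bar R) (S : set V) : Prop :=
  [/\ closed S, mu (~` S) = 0%E
    & forall C, closed C -> mu (~` C) = 0%E -> S `<=` C].

(* k x is a (regular) conditional distribution of Y given X = x *)
Definition is_cond_dist (R : realType) d d' (Omega : measurableType d)
    (E : measurableType d') (P : probability Omega R)
    (Y : {RV P >-> R}) (X : {RV P >-> E})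
    (k : R.-pker E ~> measurableTypeR R) : Prop :=
  forall (A : set E) (B : set (measurableTypeR R)),
    measurable A -> measurable B ->
    P (X @^-1` A `&` Y @^-1` B) = (\int[P]_(w in X @^-1` A) k (X w) B)%E.

Definition cond_cdf (R : realType) d (E : measurableType d)
    (k : R.-pker E ~> measurableTypeR R) (y : R) (x : E) : R :=
  fine (k x `]-oo, y]%classic).

(* inf {y in D | tau <= G y}. With D = setT this is the plain generalized
   inverse, whose value at level 0 is -oo as soon as G >= 0. With D = [s1, s2]
   the support of the distribution function G, the levels 0 and 1 are sent to
   s1 and s2, and the other levels keep their usual quantile. *)
Definition quantile (R : realType) (D : set R) (G : R -> R) (tau : R) : \bar R :=
  ereal_inf [set y%:E | y in [set y | D y /\ tau <= G y]].

(* z0 attains the minimum of q(z + 1 - alpha) - q(z) over z in [0, alpha] *)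
Definition shortest_level (R : realType) (alpha : R) (q : R -> \bar R)
    (z0 : R) : Prop :=
  0 <= z0 <= alpha /\
  forall z, 0 <= z <= alpha ->
    (q (z0 + 1 - alpha)%R - q z0 <= q (z + 1 - alpha)%R - q z)%E.

(* (z1, z2) minimizes z2 - z1 subject to G z2 - G z1 >= 1 - alpha *)
Definition shortest_interval (R : realType) (alpha : R) (G : R -> R)
    (z1 z2 : R) : Prop :=
  1 - alpha <= G z2 - G z1 /\
  forall z1' z2', 1 - alpha <= G z2' - G z1' -> z2 - z1 <= z2' - z1'.

(* Observations are numbered from 0: the training set is {0, ..., n1 - 1}, the
   calibration set is {n1, ..., n1 + n2 - 1}, the test point has index n1 + n2. *)
Definition train (R : realType) (Omega V : Type) (n1 : nat)
    (Y : nat -> Omega -> R) (X : nat -> Omega -> V) (w : Omega) :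
    n1.-tuple (R * V) :=
  [tuple (Y i w, X i w) | i < n1].

Definition calib_mean (R : realType) (n1 n2 : nat) (a : nat -> R) : R :=
  n2%:R^-1 * \sum_(n1 <= t < n1 + n2) a t.

Definition score (R : realType) (V : Type) (alpha : R)
    (G : R -> V -> R) (c : V -> R) (y : R) (x : V) : R :=
  G y x - c x - 2^-1 * (1 - alpha).

(* The (1 - alpha)(1 + 1/n2) empirical quantile of |v t| over the calibration
   set; it is +oo when this level exceeds 1. *)
Definition calib_quantile (R : realType) (alpha : R) (n1 n2 : nat)
    (v : nat -> R) : \bar R :=
  quantile setT (fun u => calib_mean n1 n2 (fun t => (`|v t| <= u)%R%:R))
    ((1 - alpha) * (1 + n2%:R^-1)).

Definition conf_set (R : realType) (V : Type) (alpha : R)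
    (G : R -> V -> R) (c : V -> R) (q : \bar R) (x : V) : set R :=
  [set y | (`|score alpha G c y x|%:E <= q)%E].

(* Main.v *)
Require Import Defs.
From HB Require Import structures.
From mathcomp Require Import lra measurable_realfun.

(* Write h = (1 - alpha)/2. Inside the conditional support F(., x) increases at
   rate at least C1, so the shortest interval is {y | |F(y,x) - b(x) - h| <= h};
   the conformal set is {y | |Fhat - bhat - h| <= Qstar}. If Fhat, bhat and
   Qstar are within e of F, b and h, the two sets differ only where F(., x) is
   within 3e of b or of b + 1 - alpha, and there the density bound limits the
   measure to 12e/C1.
   Given X, U = F(Y, X) is uniform on [0, 1], so Gstar(v) is the expectation of
   b(X) + v + h clamped to [0, 1]. As b is in [0, alpha], the mass that Gstar
   gives to [-u, u] crosses the level 1 - alpha at u = h with slope bounded away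
   from 0; uniform closeness of the empirical distribution then forces Qstar to
   be close to h.
   Over the whole line one also needs b(X_t) to stay away from 0 and alpha
   uniformly in t, although the X_t need not be identically distributed: Gstar
   is the same for all t and determines E min(b(X_t), eta) and
   E min(alpha - b(X_t), eta). *)

Set Implicit Arguments.
Unset Strict Implicit.
Unset Printing Implicit Defensive.

(** * Conditional distributions *)

Section cond_dist.
Context (R : realType) d d' (Omega : measurableType d)
  (E : measurableType d') (P : probability Omega R).
Variables (Y : {RV P >-> R}) (X : {RV P >-> E})
  (k : R.-pker E ~> measurableTypeR R).

Lemma measurable_kernel_xsection (S : set (E * measurableTypeR R)) :
  measurable S -> measurable_fun setT (fun w => k (X w) (xsection S (X w))).
Proof.
move=> mS.
apply: (measurableT_comp (f := fun x => k x (xsection S x))).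
  by apply: measurable_fun_xsection_finite_kernel; rewrite inE.
exact: (measurable_funPT X).
Qed.

(** [is_cond_dist] speaks of rectangles only. These generate the product sigma-algebra and are
    stable under intersection, and the sets satisfying the identity form a Dynkin system. *)
Lemma cond_dist_xsection (S : set (E * measurableTypeR R)) :
  is_cond_dist Y X k -> measurable S ->
  P [set w | S (X w, Y w)] = (\int[P]_w k (X w) (xsection S (X w)))%E.
Proof.
move=> Hk mS.
have mpre S' : measurable S' -> measurable [set w | S' (X w, Y w)].
  move=> mS'; rewrite -[X in measurable X]setTI.
  have mXY : measurable_fun setT (fun w => (X w, Y w : measurableTypeR R)).
    apply/measurable_fun_pairP; split; first exact: (measurable_funPT X).
    exact: (measurable_funPT Y).
  exact: mXY.
pose HP S' := P [set w | S' (X w, Y w)] =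
  (\int[P]_w k (X w) (xsection S' (X w)))%E.
move: mS; rewrite measurable_prod_measurableType.
apply: (@dynkin_induction _ _ _ HP); rewrite /HP => /=.
- by rewrite measurable_prod_measurableType.
- move=> _ _ [A1 mA1 [A2 mA2 <-]] [B1 mB1 [B2 mB2 <-]].
  exists (A1 `&` B1); first exact: measurableI.
  by exists (A2 `&` B2); [exact: measurableI|rewrite setXI].
- rewrite [X in P X](_ : _ = setT) ?probability_setT; last exact/seteqP.
  under eq_integral do rewrite xsectionE preimage_setT prob_kernel.
  by rewrite integral_cst// mul1e; exact/esym/probability_setT.
- move=> _ [A mA [B mB <-]].
  rewrite [X in P X](_ : _ = X @^-1` A `&` Y @^-1` B)//.
  rewrite Hk// [LHS]integral_mkcond; apply: eq_integral => w _.
  have [XA|XA] := pselect (A (X w)).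
    by rewrite patchT ?inE// in_xsectionX// inE.
  by rewrite patchN ?notin_xsectionX ?measure0// notin_setE.
(* Complements: the sections have mass at most 1, so the subtraction from 1 may be done under the
   integral. *)
- move=> T mT HT.
  transitivity (1 - P [set w | T (X w, Y w)])%E.
    by rewrite -[RHS]probability_setC//; exact: mpre.
  rewrite HT; transitivity (\int[P]_w (1 - k (X w) (xsection T (X w))))%E.
    rewrite integralB//=.
    - congr (_ - _)%E; rewrite integral_cst// mul1e.
      exact/esym/probability_setT.
    - exact: (finite_measure_integrable_cst P 1).
    - apply: (le_integrable measurableT
        _ _ (finite_measure_integrable_cst P 1 measurableT)).
        exact: measurable_kernel_xsection.
      move=> w _ /=; rewrite normr1 gee0_abs//.
      rewrite -(prob_kernel (s := k) (X w)); apply: le_measure; rewrite ?inE//.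
      exact: measurable_xsection.
  apply: eq_integral => w _; rewrite [RHS](_ : _ = k (X w) (~` xsection T (X w))).
    rewrite -(prob_kernel (s := k) (X w)) -setTD measureD//.
    - by rewrite setTI.
    - exact: measurable_xsection.
    - by rewrite [ltLHS](prob_kernel (s := k)) ltry.
  by rewrite !xsectionE.
- move=> F mF tF HF.
  rewrite [X in P X](_ : _ = \bigcup_n [set w | F n (X w, Y w)]) => //.
  rewrite measure_semi_bigcup//=; last 3 first.
  - by move=> n; exact: mpre.
  - move=> i j _ _ [w [Fi Fj]]; apply: (tF i j) => //.
    by exists (X w, Y w).
  - by apply: bigcupT_measurable => n; exact: mpre.
  under eq_integral do rewrite xsection_bigcup.
  transitivity (\int[P]_w (\sum_(n <oo) k (X w) (xsection (F n) (X w))))%E.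
    rewrite integral_nneseries//.
      by apply: eq_eseriesr => n _; exact: HF.
    by move=> n; apply: measurable_kernel_xsection; exact: mF.
  apply: eq_integral => w _; have mFw n := measurable_xsection (X w) (mF n).
  rewrite measure_semi_bigcup//; first exact: trivIset_xsection.
  exact: bigcupT_measurable.
Qed.

End cond_dist.

Section cond_cdf_measurable.
Context (R : realType) d (E : measurableType d).
Variable k : R.-pker E ~> measurableTypeR R.

(* k seen as a kernel from E * R: the joint measurability of (x, y) |-> F(y, x)
   becomes that of the sections of {((x, y), z) | z <= y} under this kernel. *)
Definition kernel_fst (z : E * measurableTypeR R) :
  {measure set (measurableTypeR R) -> \bar R} := k z.1.

Let measurable_kernel_fst U :
  measurable U -> measurable_fun [set: _] (kernel_fst ^~ U).
Proof.
move=> mU; apply: (measurableT_comp (f := k ^~ U)); first exact: measurable_kernel.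
exact: measurable_fst.
Qed.

HB.instance Definition _ :=
  isKernel.Build _ _ _ _ _ kernel_fst measurable_kernel_fst.

Let kernel_fst_setT z : kernel_fst z setT = 1%E.
Proof. exact: prob_kernel. Qed.

HB.instance Definition _ :=
  Kernel_isProbability.Build _ _ _ _ _ kernel_fst kernel_fst_setT.

Lemma measurable_cond_cdf :
  measurable_fun setT (fun z : E * measurableTypeR R => cond_cdf k z.2 z.1).
Proof.
pose A := [set t : (E * measurableTypeR R) * measurableTypeR R | t.2 <= t.1.2].
have mA : measurable A.
  rewrite -[A]setTI; apply: measurable_fun_le => //=.
  exact: (measurableT_comp measurable_snd measurable_fst).
apply: measurableT_comp => //.
rewrite (_ : (fun z => _) = fun z => kernel_fst z (xsection A z)).
  by apply: measurable_fun_xsection_finite_kernel; rewrite inE.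
apply/funext => z; congr (k z.1 _).
by apply/seteqP; split => y; rewrite /= xsectionE/= in_itv.
Qed.

End cond_cdf_measurable.

(** * Distribution functions with density bounded below *)

(** [steep_incr] is the integrated form of a density bounded below by [c] on the support, so that
    later arguments never differentiate [G]. *)
Record steep_cdf (R : realType) (G : R -> R) (s1 s2 c : R) : Prop := SteepCdf {
  steep_nd : {homo G : y y' / y <= y'};
  steep_cont : continuous G;
  steep_l : G s1 = 0;
  steep_r : G s2 = 1;
  steep01 : forall y, 0 <= G y <= 1;
  steep_gt0 : 0 < c;
  steep_incr : forall y y', s1 <= y -> y <= y' -> y' <= s2 ->
    c * (y' - y) <= G y' - G y }.

Section cond_cdf_steep.
Context (R : realType) d (E : measurableType d).
Variables (k : R.-pker E ~> measurableTypeR R) (x : E).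
Let kT : k x setT = 1%E := prob_kernel x.
Let kfin (A : set R) : measurable A -> k x A \is a fin_num.
Proof.
move=> mA; rewrite ge0_fin_numE// (@le_lt_trans _ _ 1%E) ?ltry// -kT.
by apply: le_measure; rewrite ?inE.
Qed.

Lemma cond_cdfE y : k x `]-oo, y]%classic = (cond_cdf k y x)%:E.
Proof. by rewrite /cond_cdf fineK// kfin. Qed.

Lemma cond_cdf_nd : {homo (cond_cdf k ^~ x) : y y' / y <= y'}.
Proof.
move=> y y' yy'; rewrite -lee_fin -!cond_cdfE; apply: le_measure; rewrite ?inE//.
by move=> z /=; rewrite !in_itv/= => /le_trans; apply.
Qed.

Lemma cond_cdf01 y : 0 <= cond_cdf k y x <= 1.
Proof.
rewrite -!lee_fin -!cond_cdfE measure_ge0/= -kT.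
by apply: le_measure; rewrite ?inE.
Qed.

(** The support carries all the mass, which fixes the values at its ends; the mean value theorem
    integrates the bound on the derivative. *)
Lemma cond_cdf_steep (s1 s2 c : R) :
  is_support (k x : set R -> \bar R) `[s1, s2] ->
  continuous (cond_cdf k ^~ x) -> 0 < c ->
  (forall y, s1 < y < s2 ->
    derivable (cond_cdf k ^~ x) y 1 /\ c <= derive1 (cond_cdf k ^~ x) y) ->
  steep_cdf (cond_cdf k ^~ x) s1 s2 c.
Proof.
move=> [_ k0 _] cF c0 dF; pose G := cond_cdf k ^~ x.
have Gl y : y < s1 -> G y = 0.
  move=> ys1; apply/EFin_inj; rewrite /G/= -cond_cdfE.
  apply: (subset_measure0 _ _ _ k0) => //; first exact: measurableC.
  move=> z /=; rewrite !in_itv/= => zy /andP[s1z _].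
  by have := le_lt_trans (le_trans s1z zy) ys1; rewrite ltxx.
have Gr : G s2 = 1.
  apply/EFin_inj; rewrite /G/= -cond_cdfE; apply/eqP.
  rewrite eq_le -{1}kT le_measure ?inE//= -kT -(setUv `]-oo, s2]%classic).
  rewrite measureU//; last 2 first.
  - exact: measurableC.
  - by rewrite setICr.
  rewrite [X in (_ + X)%E](_ : _ = 0%E) ?adde0//.
  apply: (subset_measure0 _ _ _ k0) => //; [exact: measurableC..|].
  move=> z /=; rewrite !in_itv/= => /negP; rewrite -ltNge => s2z /andP[_].
  by rewrite leNgt s2z.
split => //; [exact: cond_cdf_nd| |exact: cond_cdf01|].
  (* By continuity, a positive value at [s1] would persist slightly to the left, where [G]
     vanishes. *)
  apply/eqP; case: eqP => // /eqP Gs1.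
  have Gs1p : 0 < G s1 by rewrite lt_neqAle eq_sym Gs1; have /andP[] := cond_cdf01 s1.
  have := cF s1 => /cvgrPdist_lt /(_ _ Gs1p) [e /= e0 He].
  have := He (s1 - e / 2); rewrite /= opprB addrCA subrr addr0.
  rewrite ger0_norm ?divr_ge0 ?ltW// ltr_pdivrMr// ltr_pMr ?ltr1n// => /(_ isT).
  rewrite -[cond_cdf k (s1 - _) x]/(G (s1 - e / 2)) Gl; last first.
    by rewrite ltrBlDr ltrDl divr_gt0.
  by rewrite subr0 -/(G s1) gtr0_norm// ltxx.
move=> y y' s1y; rewrite le_eqVlt => /predU1P[->|yy'] y's2.
  by rewrite !subrr mulr0.
(* The open interval avoids [s1] and [s2], where no derivative is assumed. *)
have dG z : z \in `]y, y'[ -> derivable G z 1 /\ c <= derive1 G z.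
  by rewrite in_itv/= => /andP[yz zy']; apply: dF; lra.
have idG z : z \in `]y, y'[ -> is_derive z 1 G (derive1 G z).
  by move=> zyy'; rewrite derive1E; exact/derivableP/(dG _ zyy').1.
have cG : {within `[y, y'], continuous G} by exact: continuous_subspaceT.
have [z zyy' ->] := MVT yy' idG cG.
by apply: ler_wpM2r; [lra|exact: (dG _ zyy').2].
Qed.

End cond_cdf_steep.

(** [lebesgue_measure] is an outer measure defined on all sets, so arbitrary symmetric differences
    can be compared. *)
Lemma le_lebesgue_measure (R : realType) (A B : set R) :
  A `<=` B -> (lebesgue_measure A <= lebesgue_measure B)%E.
Proof.
move=> AB.
rewrite /lebesgue_measure /lebesgue_stieltjes_measure /measure_extension.
exact: le_mu_ext.
Qed.

Section steep_cdf_theory.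
Context (R : realType) (G : R -> R) (s1 s2 c : R).
Hypothesis sG : steep_cdf G s1 s2 c.

Lemma steep_lt : s1 < s2.
Proof.
rewrite ltNge; apply/negP => /(steep_nd sG).
by rewrite (steep_l sG) (steep_r sG); lra.
Qed.


Lemma steep_out_l y : y <= s1 -> G y = 0.
Proof.
move=> /(steep_nd sG); rewrite (steep_l sG) => Gy0.
by apply/eqP; rewrite eq_le Gy0; have /andP[] := steep01 sG y.
Qed.

Lemma steep_out_r y : s2 <= y -> G y = 1.
Proof.
move=> /(steep_nd sG); rewrite (steep_r sG) => Gy1.
by apply/eqP; rewrite eq_le Gy1; have /andP[_ ->] := steep01 sG y.
Qed.

Lemma steep_ivt t : 0 <= t <= 1 -> exists2 q, s1 <= q <= s2 & G q = t.
Proof.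
move=> t01; have := @IVT R G s1 s2 t (ltW steep_lt) (continuous_subspaceT (steep_cont sG)).
rewrite (steep_l sG) (steep_r sG) min_l// max_r// => /(_ t01)[q].
by rewrite in_itv/=; exists q.
Qed.

Lemma ler_steep y y' : s1 <= y <= s2 -> s1 <= y' <= s2 -> (G y <= G y') = (y <= y').
Proof.
move=> /andP[s1y ys2] /andP[s1y' y's2]; apply/idP/idP; last exact: (steep_nd sG).
move=> Gyy'; rewrite leNgt; apply/negP => y'y.
have := steep_incr sG s1y' (ltW y'y) ys2.
have : 0 < c * (y - y') by rewrite mulr_gt0 ?subr_gt0// (steep_gt0 sG).
by lra.
Qed.

(** [G] is strictly increasing on the support, so the generalized inverse is a true inverse there,
    levels 0 and 1 included. *)
Lemma quantile_steep q : s1 <= q <= s2 -> quantile `[s1, s2] G (G q) = q%:E.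
Proof.
move=> qs; apply/eqP; rewrite eq_le; apply/andP; split.
  by apply: ereal_inf_lbound; exists q.
apply: le_ereal_inf_tmp => _ [y [ys Gqy] <-]; rewrite lee_fin -ler_steep//.
Qed.

(** An end outside the support could be moved to it without losing mass, and a slack constraint
    would allow a shorter interval. The ends are thus quantiles whose levels differ by
    [1 - alpha]. *)
Lemma shortest_interval_steep alpha r1 r2 b : 0 < alpha < 1 ->
  shortest_interval alpha G r1 r2 ->
  (forall z, shortest_level alpha (quantile `[s1, s2] G) z <-> z = b) ->
  [/\ 0 <= b <= alpha, s1 <= r1 <= s2, s1 <= r2 <= s2, G r1 = b
    & G r2 = b + 1 - alpha].
Proof.
move=> alpha01 [r12 rmin] Hb.
have Gr1 := steep01 sG r1; have Gr2 := steep01 sG r2.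
have s1r1 : s1 <= r1.
  rewrite leNgt; apply/negP => r1s1; have := rmin s1 r2.
  by rewrite (steep_l sG); have := steep_out_l (ltW r1s1); lra.
have r2s2 : r2 <= s2.
  rewrite leNgt; apply/negP => s2r2; have := rmin r1 s2.
  by rewrite (steep_r sG); have := steep_out_r (ltW s2r2); lra.
have r12' : r1 <= r2.
  by rewrite leNgt; apply/negP => /ltW /(steep_nd sG); lra.
have r1s : s1 <= r1 <= s2 by lra.
have r2s : s1 <= r2 <= s2 by lra.
(* [q] makes the constraint tight; it is feasible and at most [r2], so minimality gives [q = r2]. *)
have [q qs Gq] : exists2 q, s1 <= q <= s2 & G q = G r1 + 1 - alpha.
  by apply: steep_ivt; lra.
have qr2 : q <= r2 by rewrite -ler_steep//; lra.
have qE : q = r2.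
  by apply/eqP; rewrite eq_le qr2/=; have := rmin r1 q; rewrite Gq; lra.
(* A competing level [z] yields a feasible interval from [u] to [v], no shorter than the optimal
   one; uniqueness of the shortest level then gives [b]. *)
have bE : G r1 = b.
  apply/Hb; split=> [|z z0]; first lra.
  have [u us Gu] : exists2 q, s1 <= q <= s2 & G q = z by apply: steep_ivt; lra.
  have [v vs Gv] : exists2 q, s1 <= q <= s2 & G q = z + 1 - alpha.
    by apply: steep_ivt; lra.
  rewrite -Gq -Gv -Gu !quantile_steep// qE -!EFinB lee_fin.
  by apply: rmin; lra.
by split => //; rewrite -?bE -?qE; lra.
Qed.

Lemma in_opt_steep alpha r1 r2 b y :
  s1 <= r1 <= s2 -> s1 <= r2 <= s2 -> G r1 = b -> G r2 = b + 1 - alpha ->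
  s1 <= y <= s2 ->
  (r1 <= y <= r2) = (`|G y - b - 2^-1 * (1 - alpha)| <= 2^-1 * (1 - alpha)).
Proof.
move=> r1s r2s Gr1 Gr2 ys; rewrite -(ler_steep r1s ys) -(ler_steep ys r2s) Gr1 Gr2 ler_norml.
by apply/idP/idP; lra.
Qed.

(** By steepness two points of the set are at most [(b - a) / c] apart, so an interval of that
    length starting at the infimum contains it. *)
Lemma lebesgue_steep_preimage a b : a <= b ->
  (lebesgue_measure [set y | s1 <= y <= s2 /\ a <= G y <= b]%R <= ((b - a) / c)%:E)%E.
Proof.
move=> ab; set S := [set y | _].
have [->|/set0P[y0 Sy0]] := eqVneq S set0.
  by rewrite measure0 lee_fin divr_ge0 ?subr_ge0// ltW// (steep_gt0 sG).
have Sdist y y' : S y -> S y' -> y' <= y + (b - a) / c.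
  move=> [ys Gy] [y's Gy']; have [|yy'] := leP y' y.
    by move/le_trans; apply; rewrite lerDl divr_ge0 ?subr_ge0// ltW// (steep_gt0 sG).
  rewrite -lerBlDl ler_pdivlMr ?(steep_gt0 sG)// mulrC.
  have := @steep_incr _ _ _ _ _ sG y y'; move: ys y's Gy Gy' yy'.
  by move=> /andP[-> _] /andP[_ ->]; lra.
have hS : has_inf S.
  by split; [exists y0|exists s1 => y [/andP[]]].
have subS : S `<=` [set` `[inf S, inf S + (b - a) / c]].
  move=> y Sy /=; rewrite in_itv/= ge_inf//=; last exact: hS.2.
  rewrite -lerBlDr; apply: lb_le_inf => [|z Sz]; first by exists y0.
  by rewrite lerBlDr; exact: Sdist.
rewrite (le_trans (le_lebesgue_measure subS))// lebesgue_measure_itv/= lte_fin.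
have bac : 0 <= (b - a) / c by rewrite divr_ge0 ?subr_ge0// ltW// (steep_gt0 sG).
by case: ifP => _; rewrite -?EFinB lee_fin// addrC addKr.
Qed.

End steep_cdf_theory.

Lemma lebesgue_measureU2 (R : realType) (A B : set R) :
  (lebesgue_measure (A `|` B) <= lebesgue_measure A + lebesgue_measure B)%E.
Proof.
rewrite /lebesgue_measure /lebesgue_stieltjes_measure /measure_extension.
exact: outer_measureU2.
Qed.

(** * Deterministic comparison of the sets and of the quantiles *)

Section symdiff.
Context (R : realType) (V : Type) (G : R -> R) (s1 s2 c : R).
Hypothesis sG : steep_cdf G s1 s2 c.
Variables (alpha : R) (Ghat : R -> V -> R) (bhat : V -> R) (q : \bar R) (x : V).
Variables (b e : R).
Let h := 2^-1 * (1 - alpha).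
Hypotheses (GhatG : forall y, `|Ghat y x - G y| <= e) (bhatb : `|bhat x - b| <= e).
Hypothesis qh : ((h - e)%:E <= q <= (h + e)%:E)%E.

Let score_near y : `|score alpha Ghat bhat y x - (G y - b - h)| <= 2 * e.
Proof.
move: (GhatG y) bhatb; rewrite /score -/h !ler_norml => /andP[? ?] /andP[? ?].
by apply/andP; split; lra.
Qed.

(** One [e] comes from [Ghat], one from [bhat] and one from [q]. *)
Lemma conf_set_le y : conf_set alpha Ghat bhat q x y -> `|G y - b - h| <= h + 3 * e.
Proof.
rewrite /conf_set/= => /le_trans /(_ (andP qh).2); rewrite lee_fin.
by move: (score_near y); rewrite !ler_norml => /andP[? ?] /andP[? ?]; apply/andP; split; lra.
Qed.

Lemma conf_setC_gt y : ~ conf_set alpha Ghat bhat q x y -> h - 3 * e < `|G y - b - h|.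
Proof.
rewrite /conf_set/= => /negP; rewrite -ltNge => /(le_lt_trans (andP qh).1).
rewrite lte_fin.
have := le_trans (ler_dist_dist _ _) (score_near y).
by rewrite ler_norml => /andP[? ?] ?; lra.
Qed.

Lemma lebesgue_symdiff_opt r1 r2 : 0 <= e ->
  s1 <= r1 <= s2 -> s1 <= r2 <= s2 -> G r1 = b -> G r2 = b + 1 - alpha ->
  (lebesgue_measure
    ((conf_set alpha Ghat bhat q x `&` `[s1, s2]) `+` `[r1, r2])
    <= (12 * e / c)%:E)%E.
Proof.
move=> e0 r1s r2s Gr1 Gr2.
(* Two bands of levels, each of width [6 * e], account for the constant 12; the sign of
   [G y - b - h] tells which band contains [y]. *)
pose S a := [set y | s1 <= y <= s2 /\ a - 3 * e <= G y <= a + 3 * e].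
have leS a : (lebesgue_measure (S a) <= (6 * e / c)%:E)%E.
  rewrite (le_trans (lebesgue_steep_preimage sG _))//; first lra.
  by rewrite (_ : a + 3 * e - (a - 3 * e) = 6 * e)//; lra.
have subS : (conf_set alpha Ghat bhat q x `&` `[s1, s2]) `+` `[r1, r2]
    `<=` S b `|` S (b + 1 - alpha).
  have inS y : s1 <= y <= s2 -> h - 3 * e <= `|G y - b - h| <= h + 3 * e ->
      (S b `|` S (b + 1 - alpha)) y.
    rewrite /h => ys; have [Gb|Gb] := ger0P (G y - b - 2^-1 * (1 - alpha)) => Ge.
      by right; split=> //; move: Ge; lra.
    by left; split=> //; move: Ge; lra.
  have ropt y := in_opt_steep sG (y := y) r1s r2s Gr1 Gr2.
  move=> y; rewrite /= !in_itv/= => -[[[Cy ys] /negP nopt]|[opt nC]]; apply: inS => //.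
  - by move: (conf_set_le Cy) nopt; rewrite ropt// /h -ltNge; lra.
  - by lra.
  - have ys : s1 <= y <= s2 by lra.
    move: opt; rewrite ropt//.
    have /conf_setC_gt : ~ conf_set alpha Ghat bhat q x y by move=> Cy; apply: nC.
    by rewrite /h; lra.
rewrite (le_trans (le_lebesgue_measure subS))// (le_trans (lebesgue_measureU2 _ _))//.
rewrite (le_trans (leeD (leS _) (leS _)))// -EFinD -mulrDl.
by rewrite (_ : 6 * e + 6 * e = 12 * e)//; lra.
Qed.

(** Outside the support [G] is 0 or 1, at distance [h + b] or [h + (alpha - b)] from the centre
    [b + h]; both exceed [h + 3 * e]. *)
Lemma conf_set_sub_support : 3 * e < b -> b < alpha - 3 * e ->
  conf_set alpha Ghat bhat q x `<=` `[s1, s2].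
Proof.
move=> eb ba y /conf_set_le; rewrite /h /= in_itv/= ler_norml => Gy.
apply/andP; split; rewrite leNgt; apply/negP => /ltW.
  by move=> /(steep_out_l sG); lra.
by move=> /(steep_out_r sG); lra.
Qed.

End symdiff.

(** * Empirical quantile of the absolute scores *)

Section calib.
Context (R : realType).

Lemma calib_meanB n1 n2 (a a' : nat -> R) :
  calib_mean n1 n2 a - calib_mean n1 n2 a' = calib_mean n1 n2 (a \- a').
Proof. by rewrite /calib_mean -mulrBr -sumrB. Qed.

Lemma ler_calib_mean n1 n2 (a a' : nat -> R) :
  (forall t, a t <= a' t) -> calib_mean n1 n2 a <= calib_mean n1 n2 a'.
Proof.
by move=> aa'; rewrite ler_wpM2l ?invr_ge0//; apply: ler_sum => t _; exact: aa'.
Qed.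

(** Each difference of two empirical distribution values costs [2 * dl]. The upper bound pays a
    third [dl] for the correction [(1 - alpha) / n2], which only helps the lower bound. *)
Lemma calib_quantile_near alpha n1 n2 (v : nat -> R) (Gs : R -> R) (h e dl : R) :
  0 < alpha < 1 -> 0 < e <= h ->
  (forall u, `|calib_mean n1 n2 (fun t => (v t <= u)%R%:R) - Gs u| <= dl) ->
  (1 - alpha) * n2%:R^-1 <= dl ->
  1 - alpha + 3 * dl <= Gs (h + e) - Gs (- (h + e)) ->
  Gs (h - e) - Gs (- (h - e / 2)) + 2 * dl < 1 - alpha ->
  ((h - e)%:E <= calib_quantile alpha n1 n2 v <= (h + e)%:E)%E.
Proof.
move=> alpha01 eh HG n2dl Hup Hlow.
have HGl u : Gs u - dl <= calib_mean n1 n2 (fun t => (v t <= u)%R%:R).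
  by move: (HG u); rewrite ler_norml; lra.
have HGr u : calib_mean n1 n2 (fun t => (v t <= u)%R%:R) <= Gs u + dl.
  by move: (HG u); rewrite ler_norml; lra.
apply/andP; split.
  apply: le_ereal_inf_tmp => _ [u [_ +] <-]; rewrite lee_fin => Hu.
  (* If [u < h - e], then [|v t| <= u] forces [v t] between [- (h - e / 2)] (excluded) and [h - e],
     an interval of too little empirical mass. *)
  rewrite leNgt; apply/negP => uh; move: Hu; apply/negP; rewrite -ltNge.
  apply: (@lt_le_trans _ _ (1 - alpha)); last first.
    by rewrite ler_peMr ?lerDl ?invr_ge0//; lra.
  apply: (le_lt_trans _ Hlow).
  apply: (@le_trans _ _ (calib_mean n1 n2 (fun t => (v t <= h - e)%R%:R)
     - calib_mean n1 n2 (fun t => (v t <= - (h - e / 2))%R%:R))); last first.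
    by have := HGr (h - e); have := HGl (- (h - e / 2)); lra.
  rewrite calib_meanB; apply: ler_calib_mean => t /=.
  by have [] := leP `|v t| u => /=; rewrite ?ler_norml => ?;
    have [] := leP (v t) (h - e) => /= ?;
    have [] := leP (v t) (- (h - e / 2)) => /=; lra.
apply: ereal_inf_lbound; exists (h + e) => //; split=> //.
rewrite mulrDr mulr1.
apply: (@le_trans _ _ (calib_mean n1 n2 (fun t => (v t <= h + e)%R%:R)
     - calib_mean n1 n2 (fun t => (v t <= - (h + e))%R%:R))).
  by have := HGl (h + e); have := HGr (- (h + e)); lra.
rewrite calib_meanB; apply: ler_calib_mean => t /=.
by have [] := leP `|v t| (h + e) => /=; rewrite ?ltr_normr => ?;
  have [] := leP (v t) (h + e) => /= ?;
  have [] := leP (v t) (- (h + e)) => /=; lra.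
Qed.
End calib.

(** * Law of the scores *)

(** The distribution function of the uniform law on [0, 1]. *)
Definition clamp01 (R : realType) (z : R) : R := Num.max 0 (Num.min 1 z).

Lemma clamp01_itv (R : realType) (z : R) : 0 <= clamp01 z <= 1.
Proof.
by rewrite /clamp01 le_max lexx ge_max ler01 ge_min lexx.
Qed.

Lemma clamp01_cases (R : realType) (z : R) :
  [\/ z <= 0 /\ clamp01 z = 0, 0 <= z <= 1 /\ clamp01 z = z
    | 1 <= z /\ clamp01 z = 1].
Proof.
rewrite /clamp01; have [z0|z0] := leP z 0.
  by constructor 1; rewrite min_r ?max_l//; lra.
have [z1|z1] := leP z 1; first by constructor 2; rewrite max_r ltW.
by constructor 3; rewrite max_r ?ltW.
Qed.

Lemma clamp01_nd (R : realType) : {homo @clamp01 R : x y / x <= y}.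
Proof.
move=> x y xy; rewrite /clamp01 /Num.max /Num.min.
by do ?case: ifP; lra.
Qed.

Lemma measurable_clamp01 (R : realType) d (T : measurableType d) (f : T -> R) :
  measurable_fun setT f -> measurable_fun setT (fun w => clamp01 (f w)).
Proof.
move=> mf; apply: measurable_maxr => //; exact: measurable_minr.
Qed.

(** The probability integral transform: for [0 <= z < 1] the set is the half-line ending at the
    point of the support where the distribution function equals [z]. *)
Lemma kernel_cond_cdf_le (R : realType) d (E : measurableType d)
    (k : R.-pker E ~> measurableTypeR R) (x : E) s1 s2 c z :
  steep_cdf (cond_cdf k ^~ x) s1 s2 c ->
  k x [set y | cond_cdf k y x <= z] = (clamp01 z)%:E.
Proof.
move=> sG; have [z0|z0] := ltP z 0.
  rewrite (_ : [set y | _] = set0) ?measure0; last first.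
    apply/seteqP; split=> y //= Gz.
    by have /andP[+ _] := steep01 sG y; lra.
  by rewrite /clamp01 min_r ?max_l//; lra.
have [z1|z1] := leP 1 z.
  rewrite (_ : [set y | _] = setT); last first.
    apply/seteqP; split=> y //= _.
    by have /andP[_] := steep01 sG y; lra.
  by rewrite (prob_kernel (s := k)) /clamp01 min_l// max_r.
have [|q qs Gq] := steep_ivt sG (t := z); first lra.
rewrite (_ : [set y | _] = `]-oo, q]%classic); last first.
  apply/seteqP; split => y /=; rewrite in_itv/=; last first.
    by move=> /(steep_nd sG)/=; rewrite Gq.
  move=> Gyz.
  have [s1y|ys1] := leP s1 y; last by lra.
  have [ys2|s2y] := leP y s2; last first.
    by have := steep_out_r sG (ltW s2y); lra.
  by rewrite -(ler_steep sG (y := y))//; lra.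
by rewrite cond_cdfE Gq /clamp01 min_r ?max_r//; lra.
Qed.

Section score_law.
Context (R : realType) d d' (Omega : measurableType d)
  (E : measurableType d') (P : probability Omega R).
Variables (Y : {RV P >-> R}) (X : {RV P >-> E})
  (k : R.-pker E ~> measurableTypeR R) (b : {mfun E >-> R}).
Variables (s1 s2 : E -> R) (c alpha : R) (Gs : R -> R).
Hypothesis Hk : is_cond_dist Y X k.
Hypothesis sF : {ae P, forall w,
  steep_cdf (cond_cdf k ^~ (X w)) (s1 (X w)) (s2 (X w)) c /\ 0 <= b (X w) <= alpha}.
Hypothesis HGs : forall v,
  P [set w | score alpha (cond_cdf k) b (Y w) (X w) <= v] = (Gs v)%:E.
Let h := 2^-1 * (1 - alpha).

Let mb : measurable_fun setT (fun w => b (X w)).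
Proof. exact: (measurableT_comp (measurable_funPT b) (measurable_funPT X)). Qed.

Let mcl v : measurable_fun setT (fun w => clamp01 (b (X w) + v)).
Proof. by apply: measurable_clamp01; exact: measurable_funD. Qed.

Lemma score_cdf v : (Gs v)%:E = (\int[P]_w (clamp01 (b (X w) + (v + h)))%:E)%E.
Proof.
(* The event that the score is at most [v], as a set of pairs whose sections have known conditional
   mass. *)
pose S := [set z : E * measurableTypeR R | cond_cdf k z.2 z.1 - b z.1 <= v + h].
have mS : measurable S.
  rewrite -[S]setTI; apply: measurable_fun_le => //=.
  apply: measurable_funB; first exact: measurable_cond_cdf.
  exact: (measurableT_comp (measurable_funPT b) measurable_fst).
rewrite -HGs (_ : [set w | _] = [set w | S (X w, Y w)]); last first.
  by apply/seteqP; split => w; rewrite /S/= /score -/h; lra.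
rewrite (cond_dist_xsection Hk mS); apply: ae_eq_integral => //.
- exact: measurable_kernel_xsection.
- exact/measurable_EFinP.
apply: filterS sF => w [sG _] _.
rewrite -(kernel_cond_cdf_le _ sG); congr (k (X w) _).
by apply/seteqP; split => y; rewrite xsectionE /S/=; lra.
Qed.

Let icl v : P.-integrable setT (EFin \o (fun w => clamp01 (b (X w) + v))).
Proof.
apply: (le_integrable measurableT _ _ (finite_measure_integrable_cst P 1 measurableT)).
  exact/measurable_EFinP.
move=> w _ /=; rewrite normr1 lee_fin; have := clamp01_itv (b (X w) + v).
by move=> /andP[z0 z1]; rewrite ger0_norm.
Qed.

Lemma score_cdfB u l : (Gs u - Gs l)%:E =
  (\int[P]_w (clamp01 (b (X w) + (u + h)) - clamp01 (b (X w) + (l + h)))%:E)%E.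
Proof.
rewrite EFinB !score_cdf -integralB_EFin//; exact: icl.
Qed.

Let mclB u l : measurable_fun setT
  (fun w => (clamp01 (b (X w) + u) - clamp01 (b (X w) + l))%:E).
Proof. by apply/measurable_EFinP/measurable_funB; exact: mcl. Qed.

(** The increment of [Gs] is an average over [b (X w)], so a bound uniform over [0, [alpha]] passes
    to it whatever the law of [X]. *)
Lemma score_cdf_ge u l m : 0 <= m -> l <= u ->
  (forall z, 0 <= z <= alpha -> m <= clamp01 (z + (u + h)) - clamp01 (z + (l + h))) ->
  m <= Gs u - Gs l.
Proof.
move=> m0 lu Hm; rewrite -lee_fin score_cdfB.
rewrite -[leLHS]mule1 -(@probability_setT _ _ _ P) -integral_cst//.
apply: ae_ge0_le_integral => //.
- by move=> w _; rewrite lee_fin subr_ge0 clamp01_nd// lerD2l lerD2r.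
- by apply: filterS sF => w [_ bw] _; rewrite lee_fin Hm.
Qed.

Lemma score_cdf_le u l m : 0 <= m -> l <= u ->
  (forall z, 0 <= z <= alpha -> clamp01 (z + (u + h)) - clamp01 (z + (l + h)) <= m) ->
  Gs u - Gs l <= m.
Proof.
move=> m0 lu Hm; rewrite -lee_fin score_cdfB.
rewrite -[leRHS]mule1 -(@probability_setT _ _ _ P) -integral_cst//.
apply: ae_ge0_le_integral => //.
- by move=> w _; rewrite lee_fin subr_ge0 clamp01_nd// lerD2l lerD2r.
- by apply: filterS sF => w [_ bw] _; rewrite lee_fin Hm.
Qed.

(** The levels from [b - e] to [b + 1 - alpha + e], cut to [0, 1], gain [min(e, b)] below and
    [min(e, alpha - b)] above; the gains add up to at least [min(e, alpha)]. *)
Lemma score_cdf_outer e : 0 < alpha < 1 -> 0 < e ->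
  1 - alpha + Num.min e alpha <= Gs (h + e) - Gs (- (h + e)).
Proof.
move=> alpha01 e0; apply: score_cdf_ge; [|rewrite /h; lra|].
  by rewrite /Num.min; case: ifP; lra.
move=> z z0; rewrite minEle /h.
have [[? ->]|[? ->]|[? ->]] :=
  clamp01_cases (z + (2^-1 * (1 - alpha) + e + 2^-1 * (1 - alpha)));
  have [[? ->]|[? ->]|[? ->]] :=
  clamp01_cases (z + (- (2^-1 * (1 - alpha) + e) + 2^-1 * (1 - alpha)));
  case: ifP => ?; lra.
Qed.

(** The levels run from [b + e / 2] to [b + 1 - alpha - e]; both ends stay in [0, 1], so clamping
    changes nothing. *)
Lemma score_cdf_inner e : 0 < alpha < 1 -> 0 < e <= h ->
  Gs (h - e) - Gs (- (h - e / 2)) <= 1 - alpha - 3 / 2 * e.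
Proof.
rewrite /h => alpha01 e0; apply: score_cdf_le; [lra|rewrite /h; lra|].
move=> z z0.
have [[? ->]|[? ->]|[? ->]] :=
  clamp01_cases (z + (2^-1 * (1 - alpha) - e + 2^-1 * (1 - alpha)));
  have [[? ->]|[? ->]|[? ->]] :=
  clamp01_cases (z + (- (2^-1 * (1 - alpha) - e / 2) + 2^-1 * (1 - alpha)));
  lra.
Qed.

(** The levels from [b - e] to [b], cut at 0, have length [min(b, e)]. The right-hand side mentions
    only [Gs], so the value is common to all observations. *)
Lemma integral_min_b e : 0 < alpha < 1 -> 0 < e ->
  (\int[P]_w (Num.min (b (X w)) e)%:E)%E = (Gs (- h) - Gs (- h - e))%:E.
Proof.
move=> alpha01 e0; rewrite score_cdfB; apply: ae_eq_integral => //.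
- by apply/measurable_EFinP; exact: measurable_minr.
apply: filterS sF => w [_ bw] _; congr EFin; rewrite /h minEle.
have [[? ->]|[? ->]|[? ->]] :=
  clamp01_cases (b (X w) + (- (2^-1 * (1 - alpha)) + 2^-1 * (1 - alpha)));
  have [[? ->]|[? ->]|[? ->]] :=
  clamp01_cases (b (X w) + (- (2^-1 * (1 - alpha)) - e + 2^-1 * (1 - alpha)));
  case: ifP => ?; lra.
Qed.

Lemma integral_min_alphaB e : 0 < alpha < 1 -> 0 < e ->
  (\int[P]_w (Num.min (alpha - b (X w)) e)%:E)%E = (Gs (h + e) - Gs h)%:E.
Proof.
move=> alpha01 e0; rewrite score_cdfB; apply: ae_eq_integral => //.
- by apply/measurable_EFinP; apply: measurable_minr => //; exact: measurable_funB.
apply: filterS sF => w [_ bw] _; congr EFin; rewrite /h minEle.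
have [[? ->]|[? ->]|[? ->]] :=
  clamp01_cases (b (X w) + (2^-1 * (1 - alpha) + e + 2^-1 * (1 - alpha)));
  have [[? ->]|[? ->]|[? ->]] :=
  clamp01_cases (b (X w) + (2^-1 * (1 - alpha) + 2^-1 * (1 - alpha)));
  case: ifP => ?; lra.
Qed.

End score_law.

(** * Truncated means and probabilities of small values *)

Section integral_min.
Context (R : realType) d (T : measurableType d) (P : probability T R).

Let prob_le_half_of_ge0_integral_min (f g : T -> R) (e : R) :
  measurable_fun setT f -> measurable_fun setT g -> 0 < e ->
  (forall w, 0 <= f w) -> (forall w, 0 <= g w) ->
  (\int[P]_w (Num.min (f w) e)%:E = \int[P]_w (Num.min (g w) e)%:E)%E ->
  ((e / 2)%:E * P [set w | f w <= e / 2]%R <= e%:E * P [set w | g w <= e]%R)%E.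
Proof.
move=> mf mg e0 f0 g0 fg.
have mle (f' : T -> R) u : measurable_fun setT f' -> measurable [set w | f' w <= u].
  by move=> mf'; rewrite -[X in measurable X]setTI; apply: measurable_fun_le.
have mmin (f' : T -> R) : measurable_fun setT f' ->
    measurable_fun setT (fun w => (Num.min (f' w) e)%:E).
  by move=> mf'; apply/measurable_EFinP; exact: measurable_minr.
have min0 (f' : T -> R) : (forall w, 0 <= f' w) ->
    forall w, (0 <= (Num.min (f' w) e)%:E)%E.
  by move=> f'0 w; rewrite lee_fin le_min f'0 ltW.
have mind (A : set T) (u : R) : measurable A ->
    measurable_fun setT (fun w => u%:E * (\1_A w : R)%:E)%E.
  by move=> mA; apply: measurable_funeM; exact/measurable_EFinP.
have split_int (f' : T -> R) (A : set T) (u : R) :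
    measurable_fun setT f' -> (forall w, 0 <= f' w) ->
    measurable A -> 0 <= u ->
    (\int[P]_w ((Num.min (f' w) e)%:E + u%:E * (\1_A w : R)%:E) =
    \int[P]_w (Num.min (f' w) e)%:E + u%:E * P A)%E.
  move=> mf' f'0 mA u0; rewrite ge0_integralD//.
  - rewrite ge0_integralZl//; last exact/measurable_EFinP.
    by rewrite integral_indic// setIT.
  - by move=> w _; exact: min0.
  - exact: mmin.
  - by move=> w _; rewrite mule_ge0// lee_fin.
  - exact: mind.
have e_int : (\int[P]_w (cst e%:E) w = e%:E)%E.
  rewrite integral_cst// [X in (_ * X)%E](_ : _ = 1%E) ?mule1//.
  exact: probability_setT.
have e2 : 0 <= e / 2 by lra.
have fle : (\int[P]_w (Num.min (f w) e)%:E + (e / 2)%:E * P [set w | f w <= e / 2]%R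
    <= e%:E)%E.
  rewrite -split_int//; last exact: mle.
  rewrite -e_int; apply: ge0_le_integral => //.
  - by move=> w _; rewrite adde_ge0 ?min0// mule_ge0// lee_fin.
  - by apply: emeasurable_funD; [exact: mmin|apply/mind/mle].
  move=> w _; rewrite /cst -EFinM -EFinD lee_fin indicE.
  by have [|] := boolP (w \in _); rewrite ?inE ?notin_setE/= ?minEle; case: ifP; lra.
have gle : (e%:E <= \int[P]_w (Num.min (g w) e)%:E + e%:E * P [set w | g w <= e]%R)%E.
  rewrite -split_int//; [|exact: mle|exact: ltW].
  rewrite -[leLHS]e_int; apply: ge0_le_integral => //.
  - by move=> w _; rewrite lee_fin ltW.
  - by apply: emeasurable_funD; [exact: mmin|apply/mind/mle].
  move=> w _; rewrite /cst -EFinM -EFinD lee_fin indicE.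
  have := g0 w.
  by have [|] := boolP (w \in _); rewrite ?inE ?notin_setE/= ?minEle; case: ifP; lra.
(* The common integral is at most [e], hence finite, and cancels. *)
move: (le_trans fle gle); rewrite fg leeD2lE//.
rewrite ge0_fin_numE; last by apply: integral_ge0 => w _; exact: min0.
rewrite (@le_lt_trans _ _ e%:E) ?ltry// (le_trans _ fle)// fg leeDl//.
by rewrite mule_ge0// lee_fin.
Qed.

(* min(f, e) <= e - (e/2) 1{f <= e/2}, while min(g, e) >= e - e 1{g <= e}. *)
Lemma prob_le_half_of_integral_min (f g : T -> R) (e : R) :
  measurable_fun setT f -> measurable_fun setT g -> 0 < e ->
  {ae P, forall w, 0 <= f w} -> {ae P, forall w, 0 <= g w} ->
  (\int[P]_w (Num.min (f w) e)%:E = \int[P]_w (Num.min (g w) e)%:E)%E ->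
  (P [set w | f w <= e / 2]%R <= 2%:E * P [set w | g w <= e]%R)%E.
Proof.
move=> mf mg e0 f0 g0 fg.
(* Passing to positive parts keeps the sublevel sets at nonnegative levels and, almost everywhere,
   the integrands. *)
have posE (f' : T -> R) (u : R) : 0 <= u ->
    [set w | Num.max 0 (f' w) <= u] = [set w | f' w <= u].
  by move=> u0; apply/seteqP; split=> w /=; rewrite ge_max u0.
have mpos (f' : T -> R) : measurable_fun setT f' ->
    measurable_fun setT (fun w => Num.max 0 (f' w)).
  by move=> mf'; exact: measurable_maxr.
have int_pos (f' : T -> R) : measurable_fun setT f' -> {ae P, forall w, 0 <= f' w} ->
    (\int[P]_w (Num.min (f' w) e)%:E = \int[P]_w (Num.min (Num.max 0 (f' w)) e)%:E)%E.
  move=> mf' f'0; apply: ae_eq_integral => //.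
  - by apply/measurable_EFinP; exact: measurable_minr.
  - by apply/measurable_EFinP/measurable_minr => //; exact: mpos.
  by apply: filterS f'0 => w f'w _; rewrite max_r.
have := @prob_le_half_of_ge0_integral_min _ _ e (mpos _ mf) (mpos _ mg) e0
  (fun w => _) (fun w => _).
have e_ge0 := ltW e0; have e2_ge0 : 0 <= e / 2 by rewrite divr_ge0.
rewrite -!int_pos// !posE// => /(_ _ _ fg) H.
have e2 : (0 < (e / 2)%:E)%E by rewrite lte_fin divr_gt0.
rewrite -(@lee_pmul2l _ (e / 2)%:E)// muleA -EFinM divfK//.
by apply: H => w; rewrite le_max lexx.
Qed.

(** Continuity from above: the sets where [f] is at most [1 / (n + 1)] decrease to a null set. *)
Lemma prob_le_small (f : T -> R) (dl : R) :
  measurable_fun setT f -> {ae P, forall w, 0 < f w} -> 0 < dl ->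
  exists2 e : R, 0 < e & (P [set w | f w <= e]%R <= dl%:E)%E.
Proof.
move=> mf f0 dl0; pose A n := [set w | f w <= n.+1%:R^-1].
have mA n : measurable (A n).
  by rewrite -[A n]setTI; apply: measurable_fun_le.
have capA : \bigcap_n A n = [set w | f w <= 0].
  apply/seteqP; split => w /=; last first.
    by move=> fw n _; rewrite /A/= (le_trans fw).
  move=> Aw; rewrite leNgt; apply/negP => fw.
  have := Aw (Num.truncn (f w)^-1) Logic.I; rewrite /A/= leNgt => /negP; apply.
  rewrite invf_plt ?posrE//.
  by rewrite truncnS_gt.
have PA0 : P (\bigcap_n A n) = 0%E.
  case: f0 => N [mN N0 fN]; apply: (subset_measure0 _ mN _ N0).
    exact: bigcapT_measurable.
  by rewrite capA => w /= fw; apply: fN => /=; lra.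
have : P (A n) @[n --> \oo] --> 0%E.
  rewrite -PA0; apply: nonincreasing_cvg_mu => //.
  - by rewrite ltey_eq fin_num_measure.
  - exact: bigcapT_measurable.
  - move=> m n mn; apply/subsetPset => w /= /le_trans; apply.
    by rewrite lef_pV2 ?posrE// ler_nat.
move=> /fine_cvgP[_ /cvgrPdist_lt /(_ _ dl0)[n _ /(_ n (leqnn n))]] /=.
rewrite sub0r normrN ger0_norm ?fine_ge0// => Pn; exists n.+1%:R^-1 => //.
rewrite -[leLHS]fineK ?fin_num_measure//; first by rewrite lee_fin ltW.
exact: mA.
Qed.

End integral_min.

(** * Convergence in probability *)

Section oP.
Context (R : realType) d (Omega : measurableType d) (P : probability Omega R).

Lemma mu_extU2 (A B : set Omega) :
  (mu_ext P (A `|` B) <= mu_ext P A + mu_ext P B)%E.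
Proof. exact: outer_measureU2. Qed.

Lemma ae_mu_ext0 (Q : Omega -> Prop) :
  {ae P, forall w, Q w} -> mu_ext P [set w | ~ Q w] = 0%E.
Proof.
move=> [N [mN PN subN]]; apply/eqP; rewrite eq_le mu_ext_ge0 ?andbT//.
by rewrite -PN -[leRHS]measurable_mu_extE//; exact: le_mu_ext.
Qed.

Lemma oP_lt (Z : nat -> Omega -> \bar R) (e dl : R) : oP P Z -> 0 < e -> 0 < dl ->
  \forall n \near \oo, (mu_ext P [set w | (e%:E < `|Z n w|)%E] <= dl%:E)%E.
Proof.
move=> ZP e0 dl0; have /fine_cvgP[finZ /cvgrPdist_lt /(_ _ dl0) cvgZ] := ZP _ e0.
near=> n; have nfin : mu_ext P [set w | (e%:E < `|Z n w|)%E] \is a fin_num by near: n.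
rewrite -[leLHS]fineK// lee_fin ltW// -[ltLHS]ger0_norm ?fine_ge0 ?mu_ext_ge0//.
rewrite -normrN -sub0r; near: n; exact: cvgZ.
Unshelve. all: by end_near. Qed.

Lemma oP_of_bounds (Z : nat -> Omega -> \bar R) :
  (forall e dl : R, 0 < e -> 0 < dl -> exists2 A : nat -> set Omega,
    (\forall n \near \oo, (mu_ext P (A n) <= dl%:E)%E) &
    \forall n \near \oo, forall w, ~ A n w -> (`|Z n w| <= e%:E)%E) ->
  oP P Z.
Proof.
move=> HZ e e0; apply/fine_cvgP.
have lt dl : 0 < dl ->
    \forall n \near \oo, (mu_ext P [set w | (e%:E < `|Z n w|)%E] <= dl%:E)%E.
  move=> dl0; have [A PA ZA] := HZ _ _ e0 dl0.
  near=> n; apply: (@le_trans _ _ (mu_ext P (A n))); last by near: n.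
  apply: le_mu_ext => w /= eZ; apply: contrapT => nA.
  move: eZ; apply/negP; rewrite -leNgt; move: w nA; near: n; exact: ZA.
split.
  near=> n; rewrite ge0_fin_numE ?mu_ext_ge0// (@le_lt_trans _ _ 1%:E) ?ltry//.
  by near: n; exact: lt.
apply/cvgrPdist_le => dl dl0; near=> n.
rewrite sub0r normrN ger0_norm ?fine_ge0 ?mu_ext_ge0//.
have nlt : (mu_ext P [set w | (e%:E < `|Z n w|)%E] <= dl%:E)%E by near: n; exact: lt.
rewrite -lee_fin fineK// ge0_fin_numE ?mu_ext_ge0//.
by rewrite (le_lt_trans nlt) ?ltry.
Unshelve. all: by end_near. Qed.

End oP.

Lemma ae_in_support (R : realType) d (Omega : measurableType d)
    (P : probability Omega R) (p : nat) (X : {RV P >-> borel_rV R p}) (S : set 'rV[R]_p) :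
  is_support (distribution P X : set 'rV[R]_p -> \bar R) S ->
  {ae P, forall w, S (X w)}.
Proof.
move=> [cS PS _]; exists (X @^-1` (~` S)); split => //.
apply: measurable_funPTI; apply: sub_sigma_algebra.
exact: closed_openC.
Qed.

Lemma ereal_sup_range_le (R : realType) (T : Type) (f : T -> R) (e : R) :
  (`|ereal_sup (range (fun y => (f y)%:E))| <= e%:E)%E -> forall y, f y <= e.
Proof.
move=> He y; rewrite -lee_fin; apply: le_trans He; apply: le_trans (lee_abs _).
by apply: ereal_sup_ubound; exists y.
Qed.

(** If [b] is 0 or [alpha] at the test point, a conformal threshold slightly above [h] can admit an
    unbounded half-line outside the support. Hence one conclusion inside the support, and one on the
    whole line for [b] strictly between. *)
Theorem theorem5
  (R : realType) (d : measure_display) (Omega : measurableType d)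
  (P : probability Omega R) (p : nat)
  (* the data, indexed from 0; calX is the support of the predictors *)
  (Y : nat -> {RV P >-> R}) (X : nat -> {RV P >-> borel_rV R p})
  (calX : set 'rV[R]_p)
  (HcalX : forall t, is_support (distribution P (X t) : set 'rV[R]_p -> \bar R) calX)
  (* F(y,x) = P(Y_t <= y | X_t = x) *)
  (k : R.-pker (borel_rV R p) ~> measurableTypeR R)
  (Hk : forall t, is_cond_dist (Y t) (X t) k)
  (HFcont : forall t,
     {ae P, forall w, continuous (fun y : R => cond_cdf k y (X t w))})
  (alpha : R) (Halpha : 0 < alpha < 1)
  (* s(x) = [s1 x, s2 x] is the conditional support of Y_t given X_t = x *)
  (s1 s2 : 'rV[R]_p -> R)
  (Hs : forall x, calX x -> is_support (k x : set R -> \bar R) `[s1 x, s2 x])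
  (* the optimal interval [r1 x, r2 x] *)
  (r1 r2 : 'rV[R]_p -> R)
  (Hr : forall x, calX x -> shortest_interval alpha (cond_cdf k ^~ x) (r1 x) (r2 x))
  (* b(x, alpha), the unique argmin *)
  (b : {mfun borel_rV R p >-> R})
  (Hb : forall x, calX x -> forall z,
     shortest_level alpha (quantile `[s1 x, s2 x] (cond_cdf k ^~ x)) z <-> z = b x)
  (* sample sizes |T_1|, |T_2| *)
  (n1 n2 : nat -> nat) (Hn1 : n1 n @[n --> \oo] --> \oo)
  (Hn2 : n2 n @[n --> \oo] --> \oo)
  (* estimators computed from the training sample *)
  (Fest : forall n, (n1 n).-tuple (R * 'rV[R]_p) -> R -> 'rV[R]_p -> R)
  (best : forall n, (n1 n).-tuple (R * 'rV[R]_p) -> 'rV[R]_p -> R)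
  (* distribution function of V_t^* *)
  (Gstar : R -> R) :
  let F : R -> 'rV[R]_p -> R := cond_cdf k in
  let Fhat n w := @Fest n (train (n1 n) Y X w) in
  let bhat n w := @best n (train (n1 n) Y X w) in
  let Vstar t w := score alpha F b (Y t w) (X t w) in
  let Vhat n t w := score alpha (Fhat n w) (bhat n w) (Y t w) (X t w) in
  let Qstar n w := calib_quantile alpha (n1 n) (n2 n) (fun t => Vhat n t w) in
  let Xtest n w := X (n1 n + n2 n)%N w in
  let Cconf n w := conf_set alpha (Fhat n w) (bhat n w) (Qstar n w) (Xtest n w) in
  let Copt x : set R := `[r1 x, r2 x]%classic in
  forall
  (HFhat : forall n w x, calX x -> {homo (Fhat n w)^~ x : y y' / y <= y'})
  (Hbhat : forall n w x, calX x ->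
     shortest_level alpha (quantile setT ((Fhat n w)^~ x)) (bhat n w x))
  (HGstar : forall t v, P [set w | Vstar t w <= v] = (Gstar v)%:E)
  (H1F : oP P (fun n w => (calib_mean (n1 n) (n2 n) (fun t =>
     (Fhat n w (Y t w) (X t w) - F (Y t w) (X t w)) ^+ 2))%:E))
  (H1b : oP P (fun n w => (calib_mean (n1 n) (n2 n) (fun t =>
     (bhat n w (X t w) - b (X t w)) ^+ 2))%:E))
  (H2 : oP P (fun n w => ereal_sup (range (fun v : R =>
     `|calib_mean (n1 n) (n2 n) (fun t => (Vhat n t w <= v)%R%:R) - Gstar v|%:E))))
  (* F(., x) vanishes left of s(x) and is 1 right of it, so it has no two-sided
     derivative at an endpoint when f >= C1 > 0 inside: f(y, x) is required in
     the interior of s(x) only *)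
  (H3 : exists2 C1 : R, 0 < C1 & forall x, calX x -> forall y, s1 x < y < s2 x ->
     derivable (F ^~ x) y 1 /\ C1 <= derive1 (F ^~ x) y)
  (H4F : oP P (fun n w => ereal_sup (range (fun y : R =>
     `|Fhat n w y (Xtest n w) - F y (Xtest n w)|%:E))))
  (H4b : oP P (fun n w => (bhat n w (Xtest n w) - b (Xtest n w))%:E))
  (H5 : exists2 C2 : R, 0 < C2 & forall x, calX x ->
     Num.max `|s1 x| `|s2 x| <= C2),
  (* y ranging over the conditional support *)
  oP P (fun n w => lebesgue_measure
    ((Cconf n w `&` `[s1 (Xtest n w), s2 (Xtest n w)]%classic) `+` Copt (Xtest n w)))
  /\
  (* y ranging over the whole line *)
  ((forall t, {ae P, forall w, 0 < b (X t w) < alpha}) ->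
   oP P (fun n w => lebesgue_measure (Cconf n w `+` Copt (Xtest n w)))).
Proof.
move=> F Fhat bhat Vstar Vhat Qstar Xtest Cconf Copt _ _ HGstar _ _ H2 [c c0 H3] H4F H4b _.
pose h := 2^-1 * (1 - alpha); have h0 : 0 < h by rewrite /h; lra.
pose regular x := steep_cdf (F ^~ x) (s1 x) (s2 x) c /\ calX x.
have reg t : {ae P, forall w, regular (X t w)}.
  apply: filterS2 (ae_in_support (HcalX t)) (HFcont t) => w Xw cFw; split => //.
  by apply: cond_cdf_steep => //; [exact: Hs|exact: H3].
have opt x (rx : regular x) :=
  shortest_interval_steep rx.1 Halpha (Hr _ rx.2) (Hb _ rx.2).
have sF t : {ae P, forall w, steep_cdf (F ^~ (X t w)) (s1 (X t w)) (s2 (X t w)) c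
    /\ 0 <= b (X t w) <= alpha}.
  by apply: filterS (reg t) => w rw; split; [exact: rw.1|have [] := opt _ rw].
have key (e dl : R) : 0 < e <= h -> 0 < dl -> exists2 A : nat -> set Omega,
    (\forall n \near \oo, (mu_ext P (A n) <= dl%:E)%E) &
    \forall n \near \oo, forall w, ~ A n w -> [/\ regular (Xtest n w),
      forall y, `|Fhat n w y (Xtest n w) - F y (Xtest n w)| <= e,
      `|bhat n w (Xtest n w) - b (Xtest n w)| <= e
    & ((h - e)%:E <= Qstar n w <= (h + e)%:E)%E].
  (* [3 * g] is exactly the outer gain [min(e, alpha)], and [2 * g] is below the inner loss
     [3 / 2 * e]. *)
  move=> /andP[e0 eh] dl0; pose g := Num.min e alpha / 3.
  have g0 : 0 < g by rewrite divr_gt0// lt_min e0; lra.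
  have ge : g <= e / 3 by rewrite ler_pM2r ?invr_gt0// ge_min lexx.
  have dl3 : 0 < dl / 3 by rewrite divr_gt0.
  (* The first set is null; each of the other three receives [dl / 3]. *)
  exists (fun n => [set w | ~ regular (Xtest n w)] `|`
    ([set w | (e%:E < `|ereal_sup (range (fun y : R =>
       `|Fhat n w y (Xtest n w) - F y (Xtest n w)|%:E))|)%E] `|`
    ([set w | (e%:E < `|(bhat n w (Xtest n w) - b (Xtest n w))%:E|)%E] `|`
     [set w | (g%:E < `|ereal_sup (range (fun v : R =>
       `|calib_mean (n1 n) (n2 n) (fun t => (Vhat n t w <= v)%R%:R)
         - Gstar v|%:E))|)%E]))).
    near=> n.
    rewrite (le_trans (mu_extU2 _ _ _))// ae_mu_ext0 ?add0e; last exact: reg.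
    rewrite (_ : dl = dl / 3 + (dl / 3 + dl / 3)); last by lra.
    rewrite !EFinD (le_trans (mu_extU2 _ _ _))// leeD//.
      by near: n; exact: oP_lt H4F e0 dl3.
    rewrite (le_trans (mu_extU2 _ _ _))// leeD//.
      by near: n; exact: oP_lt H4b e0 dl3.
    by near: n; exact: oP_lt H2 g0 dl3.
  have n2g : \forall n \near \oo, (1 - alpha) * (n2 n)%:R^-1 <= g.
    have n2r : \forall n \near \oo, ((1 - alpha) / g <= (n2 n)%:R).
      have /cvgryPge := cvg_comp _ _ Hn2 (@cvgr_idn R); exact.
    near=> n; have ng : (1 - alpha) / g <= (n2 n)%:R by near: n.
    have n20 : 0 < (n2 n)%:R :> R.
      by rewrite (lt_le_trans _ ng)// divr_gt0//; lra.
    by rewrite ler_pdivrMr// mulrC -ler_pdivrMr.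
  near=> n => w /not_orP[/contrapT rX] /not_orP[/negP + ] /not_orP[/negP + /negP +].
  rewrite -!leNgt => supF bb supG; split => //.
  - exact: ereal_sup_range_le supF.
  - apply: (calib_quantile_near Halpha (Gs := Gstar) (dl := g)).
    + by rewrite e0.
    + exact: ereal_sup_range_le supG.
    + by near: n.
    (* [Gstar] is the same for all observations, so index 0 serves to evaluate it. *)
    + have := score_cdf_outer (Hk 0%N) (sF 0%N) (HGstar 0%N) Halpha e0.
      by rewrite -/h /g; lra.
    + have := score_cdf_inner (Hk 0%N) (sF 0%N) (HGstar 0%N) Halpha (e := e).
      by rewrite e0 eh => /(_ isT); rewrite -/h; lra.
have bound (e : R) n w : 0 < e ->
    [/\ regular (Xtest n w),
      forall y, `|Fhat n w y (Xtest n w) - F y (Xtest n w)| <= e,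
      `|bhat n w (Xtest n w) - b (Xtest n w)| <= e
    & ((h - e)%:E <= Qstar n w <= (h + e)%:E)%E] ->
    (`|lebesgue_measure ((Cconf n w `&` `[s1 (Xtest n w), s2 (Xtest n w)]%classic)
      `+` Copt (Xtest n w))| <= (12 * e / c)%:E)%E.
  move=> e0 [rX Fe be qe]; have [_ r1s r2s Gr1 Gr2] := opt _ rX.
  rewrite gee0_abs//; exact: (lebesgue_symdiff_opt rX.1 Fe be qe (ltW e0) r1s r2s Gr1 Gr2).
split.
  (* The cap [h] meets the requirement of [key]; the other makes [12 * e' / c] at most [e]. *)
  apply: oP_of_bounds => e dl e0 dl0; pose e' := Num.min h (e * c / 12).
  have e'0 : 0 < e' by rewrite lt_min h0 divr_gt0 ?mulr_gt0.
  have [|A PA HA] := key e' dl _ dl0; first by rewrite e'0 ge_min lexx.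
  exists A => //; apply: filterS HA => n HA w /HA /(bound _ _ _ e'0) Hb'.
  rewrite (le_trans Hb')// lee_fin ler_pdivrMr//.
  by have : e' <= e * c / 12; [rewrite ge_min lexx orbT|lra].
move=> b01.
apply: oP_of_bounds => e dl e0 dl0.
have mb t : measurable_fun setT (fun w => b (X t w)).
  exact: (measurableT_comp (measurable_funPT b) (measurable_funPT (X t))).
have mab t : measurable_fun setT (fun w => alpha - b (X t w)).
  exact: measurable_funB.
have dl8 : 0 < dl / 8 by rewrite divr_gt0.
(* The test index moves with [n], so thresholds are chosen once, for index 0, and then transferred
   to every index. *)
have [u u0 Pu] : exists2 u : R, 0 < u & (P [set w | b (X 0%N w) <= u]%R <= (dl / 8)%:E)%E.
  apply: prob_le_small => //.
  by apply: filterS (b01 0%N) => w /andP[].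
have [v v0 Pv] : exists2 u : R, 0 < u & (P [set w | alpha - b (X 0%N w) <= u]%R <= (dl / 8)%:E)%E.
  apply: prob_le_small => //.
  by apply: filterS (b01 0%N) => w /andP[_]; rewrite subr_gt0.
(* Equality of the truncated means transfers the bound at the price of half the threshold and twice
   the probability. *)
have Pbu t : (P [set w | b (X t w) <= u / 2]%R <= (dl / 4)%:E)%E.
  rewrite (le_trans (prob_le_half_of_integral_min (mb t) (mb 0%N) u0 _ _ _))//.
  - by apply: filterS (sF t) => w [_ /andP[]].
  - by apply: filterS (sF 0%N) => w [_ /andP[]].
  - by rewrite !(integral_min_b (Hk _) (sF _) (HGstar _) Halpha u0).
  - rewrite (_ : dl / 4 = 2 * (dl / 8)); last by lra.
    by rewrite EFinM lee_pmul2l.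
have Pbv t : (P [set w | alpha - b (X t w) <= v / 2]%R <= (dl / 4)%:E)%E.
  rewrite (le_trans (prob_le_half_of_integral_min (mab t) (mab 0%N) v0 _ _ _))//.
  - by apply: filterS (sF t) => w [_ /andP[_]]; rewrite subr_ge0.
  - by apply: filterS (sF 0%N) => w [_ /andP[_]]; rewrite subr_ge0.
  - by rewrite !(integral_min_alphaB (Hk _) (sF _) (HGstar _) Halpha v0).
  - rewrite (_ : dl / 4 = 2 * (dl / 8)); last by lra.
    by rewrite EFinM lee_pmul2l.
(* With [u / 8] and [v / 8], [3 * e'] stays below [u / 2] and [v / 2], as the inclusion in the
   support demands. *)
pose e' := Num.min (Num.min h (e * c / 12)) (Num.min (u / 8) (v / 8)).
have e'0 : 0 < e' by rewrite !lt_min h0 !divr_gt0 ?mulr_gt0.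
have [e'h e'e e'u e'v] : [/\ e' <= h, e' <= e * c / 12, e' <= u / 8 & e' <= v / 8].
  by rewrite /e'; split; rewrite !ge_min lexx ?orbT.
have [||A PA HA] := key e' (dl / 2); [by rewrite e'0|by rewrite divr_gt0|].
exists (fun n => A n `|` ([set w | b (Xtest n w) <= u / 2]
                 `|` [set w | alpha - b (Xtest n w) <= v / 2])).
  near=> n; rewrite (_ : dl = dl / 2 + (dl / 4 + dl / 4)); last by lra.
  rewrite !EFinD (le_trans (mu_extU2 _ _ _))// leeD//; first by near: n.
  rewrite (le_trans (mu_extU2 _ _ _))// leeD//.
    rewrite [leLHS]measurable_mu_extE; first exact: Pbu.
    by rewrite -[X in measurable X]setTI; apply: measurable_fun_le => //; exact: mb.
  rewrite [leLHS]measurable_mu_extE; first exact: Pbv.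
  by rewrite -[X in measurable X]setTI; apply: measurable_fun_le => //; exact: mab.
apply: filterS HA => n HA w /not_orP[/HA Hn] /not_orP[/negP + /negP +];
rewrite -!ltNge => bu bv.
have [rX Fe be qe] := Hn; have := bound _ _ _ e'0 Hn.
(* The conformal set already lies in the support, so the bound for the intersection applies to
   it. *)
rewrite (setIidl _); last first.
  by apply: (conf_set_sub_support rX.1 Fe be qe); lra.
by move/le_trans; apply; rewrite lee_fin ler_pdivrMr//; lra.
Unshelve. all: by end_near. Qed.
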